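(* Every non-degenerate solution $(X,\sigma,\tau)$ is bijective, i.e. the map $r\colon X^2\to X^2$, $r(x,y)=(\sigma_x(y),\tau_y(x))$, is a bijection.
   Context: A (set-theoretic) solution (of the Yang-Baxter equation) $(X,\sigma,\tau)$ is a set $X$ (of arbitrary cardinality) with maps $\sigma,\tau\colon X^2\to X$ such that, writing $\sigma_x(y)=\sigma(x,y)$ and $\tau_y(x)=\tau(x,y)$, the map $r\colon X^2\to X^2$, $r(x,y)=(\sigma_x(y),\tau_y(x))$ satisfies the braid relation $(\mathrm{id}\times r)(r\times \mathrm{id})(\mathrm{id}\times r)=(r\times \mathrm{id})(\mathrm{id}\times r)(r\times \mathrm{id})$ on $X^3$. It is non-degenerate if all $\sigma_x$ and all $\tau_y$ ($x,y\in X$) are bijections of $X$. *)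

(* Defs.v *)
From mathcomp Require Import all_boot.

Set Implicit Arguments.
Unset Strict Implicit.
Unset Printing Implicit Defensive.

Section SetTheoreticYangBaxter.

Variable X : Type.
Implicit Types (sigma tau : X * X -> X) (r : X * X -> X * X).

Definition sigma_at sigma (x : X) : X -> X := fun y => sigma (x, y).

(* The index of tau_y is the second argument of tau : tau_y(x) = tau(x, y). *)
Definition tau_at tau (y : X) : X -> X := fun x => tau (x, y).

Definition yb_map sigma tau : X * X -> X * X :=
  fun p => (sigma_at sigma p.1 p.2, tau_at tau p.2 p.1).

(* X^3 is X * X * X, that is, the triple (x, y, z) is ((x, y), z). *)
Definition r_times_id r : X * X * X -> X * X * X :=
  fun t => let: (x, y, z) := t in (r (x, y), z).

Definition id_times_r r : X * X * X -> X * X * X :=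
  fun t => let: (x, y, z) := t in let: (y', z') := r (y, z) in (x, y', z').

Definition braid_relation r : Prop :=
  id_times_r r \o r_times_id r \o id_times_r r
    =1 r_times_id r \o id_times_r r \o r_times_id r.

Definition yb_solution sigma tau : Prop := braid_relation (yb_map sigma tau).

Definition nondegenerate sigma tau : Prop :=
  (forall x : X, bijective (sigma_at sigma x)) /\
  (forall y : X, bijective (tau_at tau y)).

End SetTheoreticYangBaxter.

(* Main.v *)
(**
Let [U x = sigma_x^-1 (x)] be the diagonal map. The braid relation gives
[U (tau_{sigma_z(c)} (x)) = tau_c (z)] whenever [z = U x], and non-degeneracy
makes [U] bijective. If [r (z, c) = (a, b)] this reads
[tau_a (U^-1 z) = U^-1 b], so that [z = U (tau_a^-1 (U^-1 b))] and
[c = sigma_z^-1 (a)] recover [(z, c)] from [(a, b)].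
*)
Require Import Defs.
From mathcomp Require Import all_boot.
From Stdlib Require Import IndefiniteDescription.

Set Implicit Arguments.
Unset Strict Implicit.
Unset Printing Implicit Defensive.

Lemma bij_surj (A B : Type) (f : A -> B) :
  bijective f -> forall b, exists a, f a = b.
Proof. by case=> g _ gK b; exists (g b). Qed.

(** As [bijective] asks for an inverse function, preimages are picked by choice. *)
Lemma inj_surj_bij (A B : Type) (f : A -> B) :
  injective f -> (forall b, exists a, f a = b) -> bijective f.
Proof.
move=> f_inj /functional_choice[g gK].
by exists g => // a; apply: f_inj; rewrite gK.
Qed.

(* In this section [s x y] is sigma_x(y), [t x y] is tau_y(x), and [s x z = x]
   expresses that [z = U x]. *)
Section Diagonal.

Variables (X : Type) (s t : X -> X -> X).
Hypothesis braid_s :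
  forall x y z, s x (s y z) = s (s x y) (s (t x y) z).
Hypothesis braid_st :
  forall x y z, s (t x (s y z)) (t y z) = t (s x y) (s (t x y) z).
Hypothesis s_inj : forall x, injective (s x).
Hypothesis s_surj : forall x z, exists y, s x y = z.
Hypothesis t_inj : forall y, injective (t^~ y).
Hypothesis t_surj : forall y z, exists x, t x y = z.

Lemma diag_s x z : s x z = x -> s (t x z) =1 s z.
Proof.
by move=> xz c; apply: (@s_inj x); rewrite [RHS]braid_s xz.
Qed.

Lemma diag_t x z c :
  s x z = x -> s (t x (s z c)) (t z c) = t x (s z c).
Proof. by move=> xz; rewrite braid_st xz diag_s. Qed.

Lemma diag_inj z x x' : s x z = x -> s x' z = x' -> x = x'.
Proof.
have [c zc] := s_surj z z.
(* The right-hand side is free of [y], so all preimages of [z] under [U] share one value of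
   [t y z]. *)
have tE y : s y z = y -> t y z = s z (t z c).
  by move=> yz; have := diag_t c yz; rewrite zc diag_s.
by move=> xz x'z; apply: (@t_inj z); rewrite /= !tE.
Qed.

(* With [w = tau_z^-1 (z)], the element [sigma_w (z)] acts by sigma as [w]
   does, hence it is a preimage of [z] under [U]. *)
Lemma diag_surj z : exists x, s x z = x.
Proof.
have [w wz] := t_surj z z; exists (s w z).
have [c zc] := s_surj z z.
by rewrite -{2 3}zc [RHS]braid_s wz.
Qed.

Lemma yb_inj z c z' c' :
  s z c = s z' c' -> t z c = t z' c' -> z = z' /\ c = c'.
Proof.
move=> eq_s eq_t.
have [x xz] := diag_surj z; have [x' xz'] := diag_surj z'.
have eq_x : x = x'.
  (* By [diag_t], [U] sends both [t x (s z c)] and [t x' (s z c)] to [t z c]. *)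
  apply: (@t_inj (s z c)); apply: (@diag_inj (t z c)); first exact: diag_t.
  by rewrite eq_s eq_t diag_t.
have eq_z : z = z' by apply: (@s_inj x); rewrite xz eq_x xz'.
by split=> //; apply: (@s_inj z); rewrite eq_s eq_z.
Qed.

Lemma yb_surj a b : exists z c, s z c = a /\ t z c = b.
Proof.
(* Here [w = U^-1 b], [p = tau_a^-1 (w)] and [z = U p]. *)
have [w wb] := diag_surj b; have [p pa] := t_surj a w.
have [z pz] := s_surj p p; have [c zc] := s_surj z a.
exists z, c; split=> //; apply: (@s_inj w).
by rewrite wb -pa -zc diag_t.
Qed.

End Diagonal.

Theorem corollary3p4 (X : Type) (sigma tau : X * X -> X)
    (hsol : yb_solution sigma tau) (hnd : nondegenerate sigma tau) :
  bijective (yb_map sigma tau).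
Proof.
case: hnd => s_bij t_bij.
pose s x y := sigma (x, y); pose t x y := tau (x, y).
have braid_s x y z : s x (s y z) = s (s x y) (s (t x y) z).
  by have [] := hsol (x, y, z).
have braid_st x y z : s (t x (s y z)) (t y z) = t (s x y) (s (t x y) z).
  by have [] := hsol (x, y, z).
have s_inj x : injective (s x) := bij_inj (s_bij x).
have t_inj y : injective (t^~ y) := bij_inj (t_bij y).
have s_surj x : forall z, exists y, s x y = z := bij_surj (s_bij x).
have t_surj y : forall z, exists x, t x y = z := bij_surj (t_bij y).
apply: inj_surj_bij => [[z c] [z' c'] [eq_s eq_t] | [a b]].
  by have [|-> ->] := yb_inj braid_s braid_st s_inj s_surj t_inj t_surj eq_s.
have [z [c [<- <-]]] := yb_surj braid_s braid_st s_inj s_surj t_surj a b.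
by exists (z, c).
Qed.
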